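(* Let $W\subset \mathrm{O}(\mathfrak h)$ be an irreducible finite real reflection group with reflection representation $\mathfrak h$ (complexified, $r=\dim\mathfrak h$), let $c:\mathcal S\to\mathbb C$ be a conjugation-invariant function on the set of reflections, and let $H=\Delta_{\mathfrak h}-\sum_{s\in\mathcal S}\frac{c_s(c_s+1)(\alpha_s,\alpha_s)}{\alpha_s^2}$. Let $P_1=\mathbf p^2,P_2,\dots,P_r$ be homogeneous algebraically independent generators of $(S\mathfrak h)^W$, of degrees $d_1,\dots,d_r$. Suppose $(L_1,\dots,L_r)$ and $(L_1',\dots,L_r')$ are two families of differential operators on $\mathfrak h$ with rational coefficients such that, for each of the two families: the $j$-th operator has symbol $P_j$ and is homogeneous of degree $-d_j$ for every $j$; the first operator is $H$; and the operators of the family commute pairwise. Then $L_j=L_j'$ for all $j=1,\dots,r$.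
   Context: $\mathfrak h$ is a finite-dimensional complex vector space with a nondegenerate symmetric inner product $(\cdot,\cdot)$. A real reflection is a semisimple $s\in \mathrm O(\mathfrak h)$ with $\operatorname{rank}(1-s)=1$; a real reflection group (finite Coxeter group) is a finite subgroup of $\mathrm O(\mathfrak h)$ generated by real reflections. $\mathcal S\subset W$ is the set of reflections, and $\alpha_s\in\mathfrak h^*$ is an eigenvector of $s$ with eigenvalue $-1$; the inner product on $\mathfrak h^*$ is the dual one. $\Delta_{\mathfrak h}$ is the Laplace operator of $\mathfrak h$. By the Chevalley–Shephard–Todd theorem $(S\mathfrak h)^W$ is a polynomial algebra; elements of $S\mathfrak h$ are viewed as polynomials in the momentum variable $\mathbf p\in\mathfrak h^*$. ''Symbol'' means the principal symbol (leading-order part). ''Homogeneous of degree $-d$'' refers to the grading in which coordinates $x\in\mathfrak h^*$ have degree $1$ and $\partial_y$, $y\in\mathfrak h$, have degree $-1$. *)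

(* Defs.v *)
From HB Require Import structures.
From mathcomp Require Import all_boot all_order all_fingroup all_algebra.
From mathcomp Require Import all_character.
From mathcomp Require Import boolp reals complex mpoly ring.

Set Implicit Arguments.
Unset Strict Implicit.
Unset Printing Implicit Defensive.

Import GRing.Theory.
Local Open Scope ring_scope.

Notation "x %:F" := (FracField.tofrac x) : ring_scope.

(* Conventions.  The space h is F^r, written as row vectors with basis
   e_1, .., e_r and inner product (u, v) = u G v^T for a symmetric invertible
   Gram matrix G; a matrix g acts on h by v |-> v g.
   - h^* is the space of column vectors, a : v |-> v a, i.e. a stands for the
     linear form \sum_i a_i x_i; its dual inner product has Gram matrix G^-1.
   - F[h] is {mpoly F[r]} in the coordinates x_i, and F(h) its fraction field.
   - S h is {mpoly F[r]} in the basis vectors e_i, i.e. polynomials on h^* in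
     the momenta p_i.  *)

Lemma quotient_rule_indep (K : fieldType) (f d q n' d' p' q' : K) :
  d != 0 -> q != 0 -> p' * d + f * q * d' = n' * q + f * d * q' ->
  (n' * d - f * d * d') / (d * d) = (p' * q - f * q * q') / (q * q).
Proof.
move=> d0 q0 E; apply/eqP; rewrite eqr_div ?mulf_neq0 //; apply/eqP.
have E2 : n' * q - f * q * d' = p' * d - f * d * q'.
  by apply/eqP; rewrite subr_eq addrAC eq_sym subr_eq E.
transitivity (d * q * (n' * q - f * q * d')); first by ring.
by rewrite E2; ring.
Qed.

Section RationalFunctions.
Variables (F : fieldType) (r : nat).

Definition ratfun : fieldType := {fraction {mpoly F[r]}}.

(* The partial derivative of num / den along x_i, by the quotient rule;
   [ratfun_derivE] shows that it does not depend on the chosen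
   representative. *)
Definition ratfun_deriv (i : 'I_r) (f : ratfun) : ratfun :=
  let num := \n_(generic_quotient.repr f) in
  let den := \d_(generic_quotient.repr f) in
  (num^`M(i) * den - num * den^`M(i))%:F / (den ^+ 2)%:F.

Lemma ratfun_repr (f : ratfun) :
  f = (\n_(generic_quotient.repr f))%:F / (\d_(generic_quotient.repr f))%:F.
Proof.
set x := generic_quotient.repr f; have d0 := denom_ratioP x.
rewrite -[LHS]generic_quotient.reprK -/x.
unlock FracField.tofrac; rewrite -[X in _ = _ * X]FracField.pi_inv.
rewrite -[RHS]FracField.pi_mul /FracField.invf /FracField.mulf.
by rewrite !numden_Ratio ?oner_eq0 // mulr1 mul1r FracField.Ratio_numden.
Qed.

Lemma ratfun_derivE (i : 'I_r) (p q : {mpoly F[r]}) : q != 0 ->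
  ratfun_deriv i (p%:F / q%:F) =
    (p^`M(i) * q - p * q^`M(i))%:F / (q ^+ 2)%:F.
Proof.
move=> q0; set f := p%:F / q%:F; rewrite /ratfun_deriv; cbv zeta.
have fE := ratfun_repr f; have /= d0 := denom_ratioP (generic_quotient.repr f).
move: fE d0; set n := \n_ _; set d := \d_ _ => fE d0.
have q0F : q%:F != 0 by rewrite tofrac_eq0.
have d0F : d%:F != 0 by rewrite tofrac_eq0.
have pE : p%:F = f * q%:F by rewrite /f (divfK q0F).
have nE : n%:F = f * d%:F by rewrite fE (divfK d0F).
have : p * d = n * q.
  by apply/eqP; rewrite -tofrac_eq !tofracM pE nE mulrAC.
move=> /(congr1 (fun u => (u^`M(i))%:F)).
rewrite !mderivM !tofracD !tofracM pE nE => E.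
rewrite !tofracN !tofracM pE nE.
exact: (quotient_rule_indep d0F q0F E).
Qed.

(* Homogeneous elements of degree k : int (0 included) of the grading of F(h)
   in which every x_i has degree 1. *)
Definition ratfun_homog (k : int) (f : ratfun) : Prop :=
  exists (dp dq : nat) (p q : {mpoly F[r]}),
    [/\ p \is dp.-homog, q \is dq.-homog & q != 0] /\
    [/\ f = p%:F / q%:F & dp%:Z - dq%:Z = k].

End RationalFunctions.

Section DifferentialOperators.
Variables (F : fieldType) (r : nat).

(* The operator \sum_m a_m d^m with rational coefficients a_m in F(h), in
   normal order (coefficients on the left), is encoded by its full symbol
   \sum_m a_m 'X_[m].  The ring product of this type is NOT the composition of
   operators, which is taken through the action [dop_act] on F(h); in
   characteristic 0 that action is faithful. *)
Definition dop : Type := {mpoly (ratfun F r)[r]}.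

Definition ratfun_derivm (m : 'X_{1..r}) (f : ratfun F r) : ratfun F r :=
  foldr (fun i g => iter (m i) (ratfun_deriv i) g) f (enum 'I_r).

Definition dop_act (L : dop) (f : ratfun F r) : ratfun F r :=
  \sum_(m <- msupp L) L@_m * ratfun_derivm m f.

Definition dop_commute (L M : dop) : Prop :=
  forall f, dop_act L (dop_act M f) = dop_act M (dop_act L f).

(* Constant-coefficient operator with full symbol P in S h, i.e. the image of
   P under e_i |-> d/dx_i. *)
Definition dop_const (P : {mpoly F[r]}) : dop :=
  map_mpoly (@FracField.tofrac {mpoly F[r]} \o @mpolyC r F) P.

(* Multiplication by a rational function. *)
Definition dop_mul (f : ratfun F r) : dop := f%:MP_[r].

(* Principal symbol: the part of top order (msize is the order plus one). *)
Definition dop_symbol (L : dop) : dop := pihomog mdeg (msize L).-1 L.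

(* Degree k for the grading deg x_i = 1, deg d/dx_i = -1. *)
Definition dop_homog (k : int) (L : dop) : Prop :=
  forall m : 'X_{1..r}, ratfun_homog (k + (mdeg m)%:Z) L@_m.

End DifferentialOperators.

Section Reflections.
Variables (F : fieldType) (r : nat) (G : 'M[F]_r).

Definition inner_product : Prop := G^T = G /\ G \in unitmx.

Definition orthogonal_mx (s : 'M[F]_r) : Prop := s *m G *m s^T = G.

(* "Semisimple" is rendered by [diagonalizable], its meaning over an
   algebraically closed field. *)
Definition real_reflection (s : 'M[F]_r) : Prop :=
  [/\ orthogonal_mx s, diagonalizable s & \rank (1%:M - s) = 1%N].

Definition dual_form (a b : 'cV[F]_r) : F := (a^T *m invmx G *m b) 0 0.

Definition lin_form (a : 'cV[F]_r) : {mpoly F[r]} := \sum_i a i 0 *: 'X_i.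

(* The element p^2 of S^2 h, i.e. the function p |-> (p, p) on h^*. *)
Definition psquare : {mpoly F[r]} :=
  \sum_i \sum_j invmx G i j *: ('X_i * 'X_j).

Definition laplacian : dop F r := dop_const psquare.

Variables (gT : finGroupType) (W : {group gT}) (rho : mx_representation F W r).

Definition reflections : {set gT} :=
  [set s in W | `[< real_reflection (rho s) >]].

(* The image of the faithful representation rho is a finite subgroup of O(h)
   generated by real reflections. *)
Definition real_reflection_group : Prop :=
  [/\ mx_faithful rho, {in W, forall g, orthogonal_mx (rho g)} &
      <<reflections>>%g = W].

(* Conjugation-invariance on the reflections; the values of c elsewhere are
   never used. *)
Definition conj_invariant (c : gT -> F) : Prop :=
  {in reflections & W, forall s g, c (s ^ g)%g = c s}.

(* g acts on h^* by a |-> a \o g^-1. *)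
Definition reflection_roots (alpha : gT -> 'cV[F]_r) : Prop :=
  {in reflections, forall s,
     alpha s != 0 /\ rho s^-1%g *m alpha s = - alpha s}.

Definition calogero_moser (c : gT -> F) (alpha : gT -> 'cV[F]_r) : dop F r :=
  laplacian - \sum_(s in reflections)
    dop_mul ((c s * (c s + 1) * dual_form (alpha s) (alpha s))%:MP_[r]%:F
             / (lin_form (alpha s))%:F ^+ 2).

(* Action on S h extending e_i |-> e_i g. *)
Definition sym_act (g : gT) (P : {mpoly F[r]}) : {mpoly F[r]} :=
  P \mPo [tuple \sum_j rho g i j *: 'X_j | i < r].

Definition sym_invariant (P : {mpoly F[r]}) : Prop :=
  {in W, forall g, sym_act g P = P}.

(* Homogeneous algebraically independent generators of (S h)^W, of degrees
   d_j, the first of which is p^2. *)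
Definition invariant_generators
    (P : 'I_r -> {mpoly F[r]}) (d : 'I_r -> nat) : Prop :=
  [/\ forall j, P j \is (d j).-homog,
      forall Q : {mpoly F[r]}, Q \mPo [tuple P j | j < r] = 0 -> Q = 0,
      forall f : {mpoly F[r]},
        sym_invariant f <->
        exists Q : {mpoly F[r]}, f = Q \mPo [tuple P j | j < r] &
      forall j : 'I_r, nat_of_ord j = 0%N -> P j = psquare].

Definition quantum_integrals (P : 'I_r -> {mpoly F[r]}) (d : 'I_r -> nat)
    (H : dop F r) (L : 'I_r -> dop F r) : Prop :=
  [/\ forall j, dop_symbol (L j) = dop_const (P j),
      forall j, dop_homog (- (d j)%:Z) (L j),
      forall j : 'I_r, nat_of_ord j = 0%N -> L j = H &
      forall i j, dop_commute (L i) (L j)].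

End Reflections.

(* Main.v *)
Require Import Defs.
From HB Require Import structures.
From mathcomp Require Import all_boot all_order all_fingroup all_algebra.
From mathcomp Require Import all_character.
From mathcomp Require Import boolp reals complex ssrcomplements mpoly zify ring.

Set Implicit Arguments.
Unset Strict Implicit.
Unset Printing Implicit Defensive.

Import GRing.Theory.
Local Open Scope ring_scope.

(* M = L_j - L'_j commutes with H, and since the symbols of L_j and L'_j agree,
   M has order n < d_j.  The terms of order n + 1 in [H, M] = 0 say that the
   principal symbol sigma of M is killed by the derivation
   delta = \sum_(i, j) (G^-1)_ij p_i d/dx_j, i.e. sigma is constant along the
   straight lines x + t G^-1 p.  The coefficients of sigma are homogeneous of
   degree n - d_j < 0; let q, of degree e, be a homogeneous common denominator.
   The coefficients of q sigma have degree < e, hence delta^e (q sigma) = 0,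
   whereas delta sigma = 0 gives delta^e (q sigma) = e! q(G^-1 p) sigma.
   Therefore sigma = 0 and M = 0. *)

(** * Homogeneous polynomials and their components *)

Section Homogeneous.
Variables (n : nat) (R : comNzRingType).
Implicit Types p : {mpoly R[n]}.

Lemma dhomog_mderiv k i p : p \is k.+1.-homog -> p^`M(i) \is k.-homog.
Proof.
move=> hp; apply/dhomogP => m; rewrite mcoeff_msupp mcoeff_mderiv => nz.
have : (m + U_(i))%MM \in msupp p.
  by rewrite mcoeff_msupp; apply: contraNneq nz => ->; rewrite mul0rn.
by move/(dhomog_mf hp); rewrite /= mdegD mdeg1 addn1 => -[].
Qed.

Lemma dhomog0_polyC p : p \is 0.-homog -> p = (p@_0)%:MP.
Proof.
move=> hp; apply/mpolyP => m; rewrite mcoeffC.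
have [->|m0] := eqVneq m 0%MM; first by rewrite mulr1.
by rewrite mulr0 (dhomog_nemf_coeff hp) //= mdeg_eq0.
Qed.

(** Euler's identity; it is the source of the factorial in [iter_flow_homog]. *)
Lemma euler_homog k p : p \is k.-homog -> \sum_i 'X_i * p^`M(i) = p *+ k.
Proof.
move=> hp.
have E i : 'X_i * p^`M(i) = \sum_(m <- msupp p) (p@_m *+ m i) *: 'X_[m].
  rewrite {1}[p]mpolyE raddf_sum mulr_sumr; apply: eq_bigr => m _ /=.
  rewrite mderivZ mderivX scalerA -scalerAr -mpolyXD mulr_natr.
  (* If [m i] is 0, truncated subtraction is not undone by adding [U_(i)] back, but then the
     coefficient is 0. *)
  have [->|mi] := eqVneq (m i) 0%N; first by rewrite !scale0r.
  congr (_ *: 'X_[_]); apply/mnmP => j; rewrite mnmDE mnmBE mnm1E addnC subnK //.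
  by case: eqP => // <-; rewrite lt0n.
rewrite (eq_bigr _ (fun i _ => E i)) exchange_big /=.
rewrite [p in RHS]mpolyE -sumrMnl !big_seq; apply: eq_bigr => m mp.
rewrite -scaler_suml sumrMnr -mdegE (dhomog_mf hp mp).
by rewrite scalerMnl.
Qed.

Lemma mcoeff_pihomog d p m :
  (pihomog mdeg d p)@_m = if mdeg m == d then p@_m else 0.
Proof.
have E k : (if mdeg k == d then p@_k *: 'X_[k] else 0)@_m
    = if k == m then (if mdeg m == d then p@_m else 0) else 0.
  case: (eqVneq k m) => [->|/negPf km]; case: ifP; rewrite ?mcoeff0 // => _.
    by rewrite mcoeffZ mcoeffX eqxx mulr1.
  by rewrite mcoeffZ mcoeffX km mulr0.
rewrite pihomogE big_mkcond raddf_sum /= (eq_bigr _ (fun k _ => E k)).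
have [mp|/memN_msupp_eq0 p0] := boolP (m \in msupp p).
  by rewrite (bigD1_seq m) ?msupp_uniq //= eqxx big1 ?addr0 // => k /negPf->.
by rewrite p0 if_same big1 // => k _; rewrite if_same.
Qed.

End Homogeneous.

(** * Derivations of a field of fractions *)

Section QuotientRule.
Variables (A : comNzRingType) (K : fieldType) (iota : {rmorphism A -> K}).

Lemma quotientB p q u v : iota q != 0 -> iota v != 0 ->
  iota p / iota q - iota u / iota v = iota (p * v - u * q) / iota (q * v).
Proof. by move=> q0 v0; rewrite rmorphB !rmorphM; field; rewrite q0 v0. Qed.

Hypothesis fracP : forall f : K, exists p q, iota q != 0 /\ f = iota p / iota q.

Section OneDerivation.
Variables (der : {additive A -> A}) (d : K -> K).
Hypothesis derM : forall p q, der (p * q) = der p * q + p * der q.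
Hypothesis dE : forall p q, iota q != 0 ->
  d (iota p / iota q) = iota (der p * q - p * der q) / iota (q ^+ 2).

Lemma quotient_rule_zmod_morphism : zmod_morphism d.
Proof.
move=> f g; have [p [q [q0 ->]]] := fracP f; have [u [v [v0 ->]]] := fracP g.
rewrite quotientB //.
have qv0 : iota (q * v) != 0 by rewrite rmorphM mulf_neq0.
rewrite !dE // (raddfB der) !derM.
by rewrite rmorphXn !rmorphB !(rmorphM, rmorphD, rmorphN) /=; field; rewrite q0 v0.
Qed.

Lemma quotient_rule_derivation f g : d (f * g) = d f * g + f * d g.
Proof.
have [p [q [q0 ->]]] := fracP f; have [u [v [v0 ->]]] := fracP g.
have -> : iota p / iota q * (iota u / iota v) = iota (p * u) / iota (q * v).
  by rewrite !rmorphM; field; rewrite q0 v0.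
have qv0 : iota (q * v) != 0 by rewrite rmorphM mulf_neq0.
rewrite !dE // !derM.
by rewrite !rmorphXn !rmorphB !(rmorphM, rmorphD, rmorphN) /=; field; rewrite q0 v0.
Qed.

Lemma quotient_rule_ext p : d (iota p) = iota (der p).
Proof.
have der1 : der 1 = 0.
  by apply: (addrI (der 1)); rewrite addr0 -[in RHS](mulr1 1) derM mulr1 mul1r.
have i1 : iota 1 != 0 by rewrite rmorph1 oner_eq0.
rewrite -[in LHS](divr1 (iota p)) -(rmorph1 iota) dE // der1 mulr0 subr0 mulr1.
by rewrite expr1n rmorph1 divr1.
Qed.

End OneDerivation.

Variables (der1 der2 : {additive A -> A}) (d1 d2 : {additive K -> K}).
Hypothesis d1M : forall f g, d1 (f * g) = d1 f * g + f * d1 g.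
Hypothesis d2M : forall f g, d2 (f * g) = d2 f * g + f * d2 g.
Hypothesis d1E : forall p, d1 (iota p) = iota (der1 p).
Hypothesis d2E : forall p, d2 (iota p) = iota (der2 p).
Hypothesis derC : forall p, der1 (der2 p) = der2 (der1 p).

(** Both composites agree on p = f q by [derC]. Expanding by Leibniz, all terms cancel except
    [d1 (d2 f)] and [d2 (d1 f)], each times the nonzero q. *)
Lemma quotient_rule_comm f : d1 (d2 f) = d2 (d1 f).
Proof.
have [p [q [q0 fE]]] := fracP f.
have E : iota p = f * iota q by rewrite fE divfK.
apply: (mulIf q0); have : d1 (d2 (iota p)) = d2 (d1 (iota p)).
  by rewrite d2E !d1E d2E derC.
rewrite E d1M d2M (raddfD d1) (raddfD d2) !d1M !d2M !d1E !d2E !d1E derC => H.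
apply: (addIr (d1 f * iota (der2 q) + d2 f * iota (der1 q) + f * iota (der2 (der1 q)))).
by apply: etrans (etrans H _); ring.
Qed.

End QuotientRule.

(* [K] and [iota] stand for [ratfun F r] and [tofrac]: keeping them abstract
   prevents unification from unfolding the quotient construction of the
   fraction field. *)
Section Operators.
Variables (F : fieldType) (r : nat) (K : fieldType).
Variables (iota : {rmorphism {mpoly F[r]} -> K}) (D : 'I_r -> {additive K -> K}).
Hypothesis charF0 : [pchar F] =i pred0.
Hypothesis iota_eq0 : forall p, (iota p == 0) = (p == 0).
Hypothesis DM : forall i f g, D i (f * g) = D i f * g + f * D i g.
Hypothesis DC : forall i j f, D i (D j f) = D j (D i f).
Hypothesis DE : forall i p, D i (iota p) = iota p^`M(i).

(** * Action of normally ordered operators on the field *)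

Implicit Types (f g : K) (L M : {mpoly K[r]}) (m : 'X_{1..r}).

(** [derivm] and [act] copy [ratfun_derivm] and [dop_act] over the abstract [K], so that the
    instances agree by conversion. *)
Definition derivm m f : K := foldr (fun i => iter (m i) (D i)) f (enum 'I_r).

Definition act L f : K := \sum_(m <- msupp L) L@_m * derivm m f.

Lemma derivm_is_zmod_morphism m : zmod_morphism (derivm m).
Proof.
move=> f g; rewrite /derivm; elim: (enum _) => //= i s ->.
by elim: (m i) => //= k ->; rewrite raddfB.
Qed.

HB.instance Definition _ m :=
  GRing.isZmodMorphism.Build K K (derivm m) (derivm_is_zmod_morphism m).

Lemma derivm0 f : derivm 0%MM f = f.
Proof. by rewrite /derivm; elim: (enum _) => //= i s ->; rewrite mnm0E. Qed.

Lemma derivmD1 m i f : derivm (m + U_(i))%MM f = derivm m (D i f).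
Proof.
have iterC k j h : iter k (D j) (D i h) = D i (iter k (D j) h).
  by elim: k => //= k ->; rewrite DC.
have foldC s h : foldr (fun j => iter (m j) (D j)) (D i h) s
               = D i (foldr (fun j => iter (m j) (D j)) h s).
  by elim: s => //= j s ->.
(* Generalised to a list of variables for induction: the extra derivative is collected where the
   list meets [i], and only once by uniqueness. *)
suff H s : uniq s ->
    foldr (fun j => iter ((m + U_(i))%MM j) (D j)) f s
    = foldr (fun j => iter (m j) (D j)) (if i \in s then D i f else f) s.
  by rewrite /derivm H ?enum_uniq // mem_enum.
elim: s => //= j s IH /andP[js us]; rewrite IH // mnmDE mnm1E inE.
case: (eqVneq i j) js => [<-|_] js; last by rewrite addn0.
by rewrite (negbTE js) addn1 iterSr -foldC.
Qed.

Lemma derivm_ext m p : derivm m (iota p) = iota p^`M[m].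
Proof.
rewrite /derivm /mderivm; elim: (enum _) => //= i s ->.
by elim: (m i) => //= k ->; rewrite DE.
Qed.

Lemma derivm_mulc m a f : (forall i, D i a = 0) -> derivm m (a * f) = a * derivm m f.
Proof.
move=> Da; rewrite /derivm; elim: (enum _) => //= i s ->.
by elim: (m i) => //= k ->; rewrite DM Da mul0r add0r.
Qed.

(** A summation range independent of the support of [L] makes linearity in the operator a termwise
    matter. *)
Lemma actwE k L f : (msize L <= k)%N ->
  act L f = \sum_(m : 'X_{1..r < k}) L@_m * derivm m f.
Proof.
move=> le_Lk; set I : subFinType _ := 'X_{1..r < k}.
rewrite /act (big_mksub I) ?msupp_uniq //=; first last.
  by move=> m /msize_mdeg_lt /leq_trans; apply.
by rewrite big_rmcond //= => m /memN_msupp_eq0 ->; rewrite mul0r.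
Qed.

Lemma actD L M f : act (L + M) f = act L f + act M f.
Proof.
pose k := maxn (msize (L + M)) (maxn (msize L) (msize M)).
rewrite !(@actwE k) ?leq_max ?leqnn ?orbT // -big_split; apply: eq_bigr => m _.
by rewrite mcoeffD mulrDl.
Qed.

Lemma act0 f : act 0 f = 0.
Proof. by rewrite /act msupp0 big_nil. Qed.

Lemma act_sum I (s : seq I) (E : I -> {mpoly K[r]}) f :
  act (\sum_(i <- s) E i) f = \sum_(i <- s) act (E i) f.
Proof. by apply: (big_morph (act^~ f)) => [L M|]; rewrite ?actD ?act0. Qed.

Lemma actZ c L f : act (c *: L) f = c * act L f.
Proof.
rewrite (@actwE (msize L)) ?msizeZ_le // (@actwE (msize L)) // mulr_sumr.
by apply: eq_bigr => m _; rewrite mcoeffZ mulrA.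
Qed.

Lemma actB L M f : act (L - M) f = act L f - act M f.
Proof. by rewrite actD -scaleN1r actZ mulN1r. Qed.

Lemma actX m f : act 'X_[m] f = derivm m f.
Proof. by rewrite /act msuppX big_seq1 mcoeffX eqxx mul1r. Qed.

Lemma actC c f : act c%:MP f = c * f.
Proof. by rewrite -[c%:MP]mulr1 mul_mpolyC -mpolyX0 actZ actX derivm0. Qed.

Lemma act_is_additive_r L : zmod_morphism (act L).
Proof.
move=> f g; rewrite /act -sumrB; apply: eq_bigr => m _.
by rewrite raddfB mulrBr.
Qed.

HB.instance Definition _ L :=
  GRing.isZmodMorphism.Build K K (act L) (act_is_additive_r L).

(** In normal order the derivatives stand rightmost, so here the product of symbols is a
    composition. *)
Lemma act_mulX L i f : act (L * 'X_i) f = act L (D i f).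
Proof.
rewrite [L in LHS]mpolyE mulr_suml act_sum; apply: eq_bigr => m _.
by rewrite -scalerAl -mpolyXD actZ actX derivmD1.
Qed.

Lemma act_mulc L a f : (forall i, D i a = 0) -> act L (a * f) = a * act L f.
Proof.
move=> Da; rewrite /act mulr_sumr; apply: eq_bigr => m _.
by rewrite derivm_mulc // mulrCA.
Qed.

(* Testing on monomials by increasing degree, [derivm m] sends ['X_[m]] to a
   nonzero constant and kills every other monomial of the same degree. *)
Lemma act_faithful L : (forall f, act L f = 0) -> L = 0.
Proof.
move=> L0; apply/mpolyP=> m; rewrite mcoeff0.
have [n] := ubnP (mdeg m); elim: n m => // n IH m; rewrite ltnS => le_mn.
have [mL|/memN_msupp_eq0 //] := boolP (m \in msupp L).
have := L0 (iota 'X_[m]); rewrite /act (bigD1_seq m) ?msupp_uniq //=.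
rewrite big_seq_cond big1 => [|k /andP[kL km]]; last first.
  have [lt_km|le_mk] := ltnP (mdeg k) (mdeg m).
    by rewrite (IH k) ?mul0r // (leq_trans lt_km).
  rewrite derivm_ext mderivmX; case: (pselect (exists i, m i < k i)%N).
    move=> [i lt_i]; rewrite (bigD1 i) //= ffact_small // mul0n scale0r.
    by rewrite rmorph0 mulr0.
  (* Now k <= m entrywise, and [mdeg m <= mdeg k] forces k = m. *)
  move=> no_i; case/eqP: km; apply/mnmP=> i.
  have le_km j : (k j <= m j)%N.
    by rewrite leqNgt; apply/negP=> lt_j; apply: no_i; exists j.
  apply/eqP; rewrite eqn_leq le_km /= leqNgt; apply/negP=> lt_i.
  move: le_mk; rewrite leqNgt !mdegE => /negP; apply.
  by rewrite (bigD1 i) // [ltnRHS](bigD1 i) //= -addSn leq_add // leq_sum.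
rewrite addr0 derivm_ext mderivmX.
have -> : (m - m = 0)%MM by apply/mnmP=> i; rewrite mnmBE subnn mnm0E.
move=> /eqP; rewrite mulf_eq0 iota_eq0.
case/orP=> [/eqP//|]; rewrite mpolyX0 -mul_mpolyC mulr1 mpolyC_eq0.
rewrite ((pcharf0P F).1 charF0); case/idPn.
by rewrite -lt0n prodn_gt0 // => i; rewrite ffact_gt0.
Qed.

(** * Derivatives of coefficients and composition of operators *)

Definition cder i : {mpoly K[r]} -> {mpoly K[r]} := map_mpoly (D i).

HB.instance Definition _ i := GRing.Additive.copy (cder i) (map_mpoly (D i)).

Lemma mcoeff_cder i M m : (cder i M)@_m = D i M@_m.
Proof. exact: mcoeff_map_mpoly. Qed.

Lemma cderZX i c m : cder i (c *: 'X_[m]) = D i c *: 'X_[m].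
Proof.
apply/mpolyP=> k; rewrite mcoeff_cder !mcoeffZ mcoeffX.
by case: (_ == _); rewrite ?mulr1 // !mulr0 raddf0.
Qed.

Lemma cderM i L M : cder i (L * M) = cder i L * M + L * cder i M.
Proof.
apply/mpolyP=> m; rewrite mcoeffD !mcoeff_cder !mcoeffM raddf_sum -big_split.
by apply: eq_bigr => k _; rewrite /= DM !mcoeff_cder.
Qed.

Lemma D1 i : D i 1 = 0.
Proof. by rewrite -(rmorph1 iota) DE -mpolyC1 mderivC rmorph0. Qed.

Lemma cderX i m : cder i 'X_[m] = 0.
Proof.
apply/mpolyP=> k; rewrite mcoeff_cder mcoeffX mcoeff0.
by case: (_ == _); rewrite ?D1 ?raddf0.
Qed.

Lemma msize_cder i M : (msize (cder i M) <= msize M)%N.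
Proof.
rewrite msizeE; apply/bigmax_leqP_seq => m mM _; apply: msize_mdeg_lt.
rewrite mcoeff_msupp; apply: contraTneq mM => M0.
by rewrite mcoeff_msupp mcoeff_cder M0 raddf0 eqxx.
Qed.

Lemma msize_mulX i M : (msize ('X_i * M) <= (msize M).+1)%N.
Proof.
have [->|M0] := eqVneq M 0; first by rewrite mulr0 msize0.
rewrite msizeM // ?msizeX ?mdeg1 //.
by rewrite -msize_poly_eq0 msizeX.
Qed.

(* d/dx_i composed with [M], in normal order. *)
Definition dleft i M := 'X_i * M + cder i M.

(** Leibniz: the new derivative falls either on the function, giving the factor ['X_i], or on the
    coefficients, giving [cder]. *)
Lemma act_dleft i M f : act (dleft i M) f = D i (act M f).
Proof.
have derivmS m : derivm m (D i f) = D i (derivm m f).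
  rewrite /derivm; elim: (enum _) => //= j s ->.
  by elim: (m j) => //= k ->; rewrite DC.
rewrite actD (mulrC 'X_i) act_mulX addrC {1}[M]mpolyE raddf_sum act_sum.
rewrite [act M _]/act [act M f]/act raddf_sum -big_split; apply: eq_bigr => m _.
by rewrite /= cderZX actZ actX DM derivmS.
Qed.

Definition dcomp L M : {mpoly K[r]} :=
  \sum_(m <- msupp L)
     L@_m *: foldr (fun i => iter (m i) (dleft i)) M (enum 'I_r).

Lemma act_dcomp L M f : act (dcomp L M) f = act L (act M f).
Proof.
rewrite act_sum; apply: eq_bigr => m _; rewrite actZ; congr (_ * _).
rewrite /derivm; elim: (enum _) => //= i s <-.
by elim: (m i) => //= k <-; rewrite act_dleft.
Qed.

Lemma msize_dleft i M : (msize (dleft i M) <= (msize M).+1)%N.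
Proof.
apply: leq_trans (msizeD_le _ _) _; rewrite geq_max msize_mulX.
by rewrite (leq_trans (msize_cder _ _)).
Qed.

(** Each [dleft] raises the order by at most one, and multiplication by f has order 0. *)
Lemma msize_dcompC L f : (msize (dcomp L f%:MP) <= msize L)%N.
Proof.
apply: leq_trans (msize_sum _ _ _) _; apply/bigmax_leqP_seq => m mL _; apply: leq_trans (msizeZ_le _ _) _.
apply: leq_trans (msize_mdeg_lt mL); rewrite mdegE -[index_enum _]enumT.
elim: (enum _) => [|i s IH] /=; first by rewrite big_nil msizeC; case: eqP.
rewrite big_cons; elim: (m i) => // k IHk /=.
exact: leq_trans (msize_dleft _ _) _.
Qed.


Definition cst (a : F) : K := iota a%:MP.

HB.instance Definition _ := GRing.RMorphism.copy cst (iota \o @mpolyC r F).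

Lemma Dcst i a : D i (cst a) = 0.
Proof. by rewrite DE mderivC rmorph0. Qed.

Lemma cderD i L M : cder i (L + M) = cder i L + cder i M.
Proof. exact: raddfD. Qed.

Lemma cderZ i a M : cder i (cst a *: M) = cst a *: cder i M.
Proof.
by apply/mpolyP=> m; rewrite !(mcoeff_cder, mcoeffZ) DM Dcst mul0r add0r.
Qed.

Lemma cder_mulX i j M : cder i ('X_j * M) = 'X_j * cder i M.
Proof. by rewrite cderM cderX mul0r add0r. Qed.

(** * The flow of the Laplacian symbol and the commutator *)

Section Flow.
Variable B : 'M[F]_r.

Definition lap : {mpoly K[r]} :=
  \sum_i \sum_j cst (B i j) *: ('X_i * 'X_j).

(** The velocity of x_j along [flow]: coordinate j of G^-1 p when [B] is the inverse Gram matrix. *)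
Definition mom j : {mpoly K[r]} := \sum_i cst (B i j) *: 'X_i.

(* Half the Poisson bracket with the symbol [lap] of the Laplacian. *)
Definition flow M : {mpoly K[r]} := \sum_j mom j * cder j M.

Lemma flow_is_zmod_morphism : zmod_morphism flow.
Proof.
by move=> L M; rewrite -sumrB; apply: eq_bigr => j _; rewrite raddfB mulrBr.
Qed.

HB.instance Definition _ :=
  GRing.isZmodMorphism.Build {mpoly K[r]} {mpoly K[r]} flow flow_is_zmod_morphism.

Lemma flowM L M : flow (L * M) = flow L * M + L * flow M.
Proof.
rewrite mulr_suml mulr_sumr -big_split; apply: eq_bigr => j _ /=.
by rewrite cderM mulrDr mulrA mulrCA.
Qed.

Lemma cder_mom i j : cder i (mom j) = 0.
Proof.
by rewrite raddf_sum big1 // => k _; rewrite /= cderZ cderX scaler0.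
Qed.

Lemma flow_cst L M : (forall i, cder i L = 0) -> flow (L * M) = L * flow M.
Proof.
by move=> L0; rewrite flowM /flow big1 ?mul0r ?add0r // => j _; rewrite L0 mulr0.
Qed.

Lemma iter_flow_cst k L M : (forall i, cder i L = 0) ->
  iter k flow (L * M) = L * iter k flow M.
Proof. by move=> L0; elim: k => //= k ->; rewrite flow_cst. Qed.

Lemma iter_flow_sum k I (s : seq I) (E : I -> {mpoly K[r]}) :
  iter k flow (\sum_(i <- s) E i) = \sum_(i <- s) iter k flow (E i).
Proof. by elim: k => //= k ->; rewrite raddf_sum. Qed.

Lemma act_lap f : act lap f = \sum_i \sum_j cst (B i j) * D j (D i f).
Proof.
rewrite act_sum; apply: eq_bigr => i _; rewrite act_sum; apply: eq_bigr => j _.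
by rewrite actZ act_mulX -['X_i]mul1r act_mulX -mpolyX0 actX derivm0 DC.
Qed.

(** The coefficients of [lap] are constants, so moving them past the derivatives in [M] creates no
    further terms. *)
Lemma act_mul_lap M f : act (M * lap) f = act M (act lap f).
Proof.
rewrite act_lap mulr_sumr act_sum raddf_sum; apply: eq_bigr => i _.
rewrite mulr_sumr act_sum raddf_sum; apply: eq_bigr => j _ /=.
rewrite -scalerAr mulrA actZ !act_mulX act_mulc 1?DC // => k.
exact: Dcst.
Qed.

Hypothesis Bsym : B^T = B.

(* The commutator of [lap] with [M] is [flow M *+ 2] up to terms of order at
   most that of [M], and the commutator of [V] with [M] only has such terms. *)
Lemma msize_flow V M :
  (forall f, act (lap - V%:MP) (act M f) = act M (act (lap - V%:MP) f)) ->
  (msize (flow M) <= msize M)%N.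
Proof.
move=> comm.
(* What the commutator relation leaves once the two copies of [flow M] are moved to the other side;
   no term has order above that of [M]. *)
pose low := V *: M - dcomp M V%:MP
  - \sum_i \sum_j cst (B i j) *: cder j (cder i M).
(* The two cross terms of [dleft j (dleft i M)]; they have the same sum because [B] is symmetric. *)
have flowE : \sum_i \sum_j cst (B i j) *: ('X_i * cder j M) = flow M.
  rewrite exchange_big; apply: eq_bigr => j _; rewrite mulr_suml.
  by apply: eq_bigr => i _; rewrite scalerAl.
have flowE' : \sum_i \sum_j cst (B i j) *: ('X_j * cder i M) = flow M.
  rewrite -flowE exchange_big; apply: eq_bigr => j _; apply: eq_bigr => i _.
  by rewrite -[in LHS]Bsym mxE.
pose left := \sum_i \sum_j cst (B i j) *: dleft j (dleft i M).
have leftE : left = M * lap + flow M + flow M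
    + \sum_i \sum_j cst (B i j) *: cder j (cder i M).
  rewrite -{1}flowE -flowE' mulr_sumr -!big_split; apply: eq_bigr => i _ /=.
  rewrite mulr_sumr -!big_split; apply: eq_bigr => j _ /=.
  rewrite -scalerAr -!scalerDr /dleft mulrDr cderD cder_mulX !addrA.
  by rewrite (addrAC _ ('X_j * _)) mulrA [_ * M]mulrC ['X_j * 'X_i]mulrC.
(* Faithfulness turns the commutation hypothesis into an identity of symbols; [left] is [lap]
   composed with [M]. *)
have : left - V *: M - (M * lap - dcomp M V%:MP) = 0.
  apply: act_faithful => f; rewrite !actB actZ act_dcomp act_mul_lap actC.
  have := comm f; rewrite !actB !actC raddfB /= => <-.
  rewrite act_lap act_sum; apply/eqP; rewrite subr_eq0; apply/eqP.
  congr (_ - _); apply: eq_bigr => i _; rewrite act_sum.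
  by apply: eq_bigr => j _; rewrite actZ !act_dleft.
rewrite leftE => E.
have {E} E : flow M *+ 2 = low.
  apply/eqP; rewrite -subr_eq0 -E /low mulr2n; apply/eqP.
  move: (M * lap) (flow M) (V *: M) (dcomp _ _) (\sum_i _) => a b u v w.
  by ring.
have two0 : 2%:R != 0 :> K.
  rewrite -(rmorph_nat iota) iota_eq0 -mpolyC_nat mpolyC_eq0.
  by rewrite ((pcharf0P F).1 charF0).
have -> : flow M = 2%:R^-1 *: low.
  by rewrite -E -scaler_nat scalerA mulVf ?scale1r.
apply: leq_trans (msizeZ_le _ _) _.
have leD L L' : (msize L <= msize M -> msize L' <= msize M ->
    msize (L + L') <= msize M)%N.
  by move=> l l'; apply: leq_trans (msizeD_le _ _) _; rewrite geq_max l.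
apply: (leD); first apply: (leD); rewrite ?msizeZ_le ?msizeN ?msize_dcompC //.
apply: leq_trans (msize_sum _ _ _) _; apply/bigmax_leqP_seq => i _ _.
apply: leq_trans (msize_sum _ _ _) _; apply/bigmax_leqP_seq => j _ _.
apply: leq_trans (msizeZ_le _ _) _.
by do 2!apply: leq_trans (msize_cder _ _) _.
Qed.

(** [flow] differentiates coefficients and multiplies by one linear form in the momenta, so it
    raises the momentum degree by exactly one. *)
Lemma flow_pihomog n M :
  flow (pihomog mdeg n M) = pihomog mdeg n.+1 (flow M).
Proof.
rewrite pihomogE raddf_sum big_mkcond /=.
have -> : flow M = \sum_(m <- msupp M) flow (M@_m *: 'X_[m]).
  by rewrite {1}[M]mpolyE raddf_sum.
rewrite raddf_sum; apply: eq_bigr => m _ /=.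
have -> : flow (M@_m *: 'X_[m])
  = \sum_j \sum_i (cst (B i j) * D j M@_m) *: 'X_[U_(i) + m].
  apply: eq_bigr => j _; rewrite cderZX mulr_suml; apply: eq_bigr => i _.
  by rewrite -scalerAl -scalerAr scalerA mpolyXD.
rewrite raddf_sum; case: eqP => [mn|mn].
  apply: eq_bigr => j _ /=; rewrite raddf_sum; apply: eq_bigr => i _ /=.
  by rewrite linearZ /= pihomogX /= mdegD mdeg1 mn eqxx.
rewrite big1 // => j _ /=; rewrite raddf_sum big1 // => i _ /=.
rewrite linearZ /= pihomogX /= mdegD mdeg1 add1n eqSS.
by case: eqP mn => // _ _; rewrite scaler0.
Qed.

(** * Polynomials in the coordinates along the flow *)

Implicit Types p q : {mpoly F[r]}.

Definition ext (p : {mpoly F[r]}) : {mpoly K[r]} := (iota p)%:MP.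

Lemma cder_ext i p : cder i (ext p) = ext p^`M(i).
Proof. by rewrite /ext -DE; apply: map_mpolyC. Qed.

Lemma flow_ext p : flow (ext p) = \sum_j mom j * ext p^`M(j).
Proof. by apply: eq_bigr => j _; rewrite cder_ext. Qed.

Lemma iterS_flow_ext k p : iter k.+1 flow (ext p) =
  \sum_j mom j * iter k flow (ext p^`M(j)).
Proof.
rewrite iterSr flow_ext iter_flow_sum; apply: eq_bigr => j _.
by rewrite iter_flow_cst // => i; apply: cder_mom.
Qed.

(** The substitution q(x) to q(G^-1 p): each x_j is replaced by its velocity. *)
Definition momev : {mpoly F[r]} -> {mpoly K[r]} := mmap (@mpolyC r K \o cst) mom.

HB.instance Definition _ := GRing.RMorphism.copy momev (mmap (@mpolyC r K \o cst) mom).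

(** The k-th derivative in t of p(x + t v) is k! p(v) for p homogeneous of degree k, with v the
    velocity. *)
Lemma iter_flow_homog k p : p \is k.-homog ->
  iter k flow (ext p) = momev p *+ k`!.
Proof.
elim: k p => [|k IH] p hp.
  by rewrite (dhomog0_polyC hp) /momev mmapC.
rewrite iterS_flow_ext (eq_bigr (fun j => momev ('X_j * p^`M(j)) *+ k`!)).
  by rewrite sumrMnl -raddf_sum (euler_homog hp) raddfMn /= -mulrnA factS.
by move=> j _; rewrite IH ?dhomog_mderiv // /momev rmorphM /= mmapX mmap1U mulrnAr.
Qed.

(** Along a line x + t v the polynomial has degree at most k in t. *)
Lemma iter_flow_homog_small k e p : p \is k.-homog -> (k < e)%N ->
  iter e flow (ext p) = 0.
Proof.
elim: e k p => // e IH [|k] p hp lt_ke; rewrite iterS_flow_ext big1 // => j _.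
  have -> : p^`M(j) = 0 by rewrite (dhomog0_polyC hp) mderivC.
  have -> : iter e flow (ext 0) = 0; last by rewrite mulr0.
  by rewrite /ext rmorph0 mpolyC0; elim: e {IH lt_ke} => //= e ->; rewrite raddf0.
by rewrite (IH k) ?mulr0 ?dhomog_mderiv.
Qed.

(** The velocities are an invertible linear change of the momenta, whose inverse [lq] has matrix
    [G]. *)
Lemma momev_inj (G : 'M[F]_r) p : G *m B = 1%:M -> momev p = 0 -> p = 0.
Proof.
move=> GB p0; pose lq := [tuple \sum_k cst (G k i) *: ('X_k : {mpoly K[r]}) | i < r].
have momK j : mom j \mPo lq = 'X_j.
  rewrite raddf_sum /= (eq_bigr (fun i => \sum_k cst (G k i * B i j) *: 'X_k)).
    rewrite exchange_big /= (bigD1 j) //= -scaler_suml.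
    have cstE k : \sum_i cst (G k i * B i j) = cst (k == j)%:R.
      rewrite -(raddf_sum iota) -(raddf_sum (@mpolyC r F)); congr (iota _%:MP).
      by move/matrixP/(_ k j): GB; rewrite !mxE.
    rewrite cstE eqxx /cst mpolyC1 rmorph1 scale1r big1 ?addr0 // => k kj.
    by rewrite -scaler_suml cstE (negbTE kj) /cst mpolyC0 rmorph0 scale0r.
  move=> i _; rewrite comp_mpolyZ comp_mpolyXU -tnth_nth tnth_mktuple scaler_sumr.
  by apply: eq_bigr => k _; rewrite scalerA /cst mpolyCM rmorphM mulrC.
have : momev p \mPo lq = 0 by rewrite p0 raddf0.
rewrite raddf_sum /= => E; apply/mpolyP => m; rewrite mcoeff0; apply/eqP.
(* Undoing the substitution leaves p itself, with its coefficients embedded in [K]. *)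
have : (map_mpoly (iota \o @mpolyC r F) p)@_m = 0.
  rewrite -(mcoeff0 _ m) -[in RHS]E; congr (_@__); apply: eq_bigr => k _.
  rewrite rmorphM /= comp_mpolyC; congr (_ * _).
  rewrite rmorph_prod; apply: eq_bigr => i _ /=.
  by rewrite rmorphXn /= momK.
by rewrite mcoeff_map_mpoly /= => /eqP; rewrite iota_eq0 mpolyC_eq0.
Qed.

(** * Coefficients of negative degree and vanishing of the commuting operator *)

Definition negdeg (a : K) : Prop :=
  exists k e (p q : {mpoly F[r]}),
    [/\ p \is k.-homog, q \is e.-homog, q != 0, a = iota p / iota q & (k < e)%N].

(** The product of the denominators works: each extra factor raises the degrees of numerator and
    denominator equally. *)
Lemma negdeg_common_den (s : seq 'X_{1..r}) (a : 'X_{1..r} -> K) :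
  (forall m, m \in s -> negdeg (a m)) ->
  exists e (q : {mpoly F[r]}), [/\ q \is e.-homog, q != 0 &
    forall m, m \in s -> exists k p,
      [/\ p \is k.-homog, (k < e)%N & a m * iota q = iota p]].
Proof.
elim: s => [|m s IH] H.
  by exists 0%N, 1; split; rewrite ?dhomog1 ?oner_eq0.
have [|e [q [hq q0 Hq]]] := IH; first by move=> k ks; apply: H; rewrite inE ks orbT.
have [k' [e' [p' [q' [hp' hq' q'0 am lt']]]]] := H m (mem_head _ _).
exists (e' + e)%N, (q' * q); split; rewrite ?dhomogM ?mulf_neq0 // => l.
rewrite inE => /predU1P[->|/Hq [k [p [hp lt_ke ap]]]].
  exists (k' + e)%N, (p' * q); split; rewrite ?dhomogM ?ltn_add2r //.
  by rewrite am !rmorphM /= mulrA divfK // iota_eq0.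
exists (e' + k)%N, (q' * p); split; rewrite ?dhomogM ?ltn_add2l //.
by rewrite !rmorphM /= mulrCA ap.
Qed.

(* If [q] is a common denominator of degree [e] of the coefficients of [M],
   then applying [flow] [e] times to [ext q * M] gives [0] by degree, and on
   the other hand [e! q(mom)] times [M] because [flow M = 0]. *)
Lemma flow_eq0 (G : 'M[F]_r) M : G *m B = 1%:M ->
  (forall m, m \in msupp M -> negdeg M@_m) -> flow M = 0 -> M = 0.
Proof.
move=> GB Mneg fM0.
have [e [q [hq q0 Hq]]] := negdeg_common_den Mneg.
have iterM k : iter k flow (ext q * M) = iter k flow (ext q) * M.
  by elim: k => //= k ->; rewrite flowM fM0 mulr0 addr0.
have : iter e flow (ext q * M) = 0.
  rewrite {1}[M]mpolyE mulr_sumr iter_flow_sum big_seq big1 // => m mM.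
  have [k [p [hp lt_ke Mq]]] := Hq m mM.
  rewrite -scalerAr /ext -mul_mpolyC mulrA -mpolyCM Mq mulrC.
  rewrite iter_flow_cst; first by rewrite (iter_flow_homog_small hp lt_ke) mulr0.
  by move=> i; rewrite cderX.
rewrite iterM (iter_flow_homog hq) => /eqP; rewrite mulf_eq0 => /orP[|/eqP//].
rewrite -mulr_natr mulf_eq0 => /orP[/eqP/(momev_inj GB) qE|].
  by rewrite qE eqxx in q0.
rewrite -mpolyC_nat mpolyC_eq0 -(rmorph_nat iota) iota_eq0 -mpolyC_nat mpolyC_eq0.
by rewrite ((pcharf0P F).1 charF0) eqn0Ngt fact_gt0.
Qed.

(** Otherwise the top component of [M] would be nonzero and constant along the flow, against
    [flow_eq0]. *)
Lemma commute_lap_eq0 (G : 'M[F]_r) V M : G *m B = 1%:M ->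
  (forall m, m \in msupp M -> negdeg M@_m) ->
  (forall f, act (lap - V%:MP) (act M f) = act M (act (lap - V%:MP) f)) ->
  M = 0.
Proof.
move=> GB Mneg comm; apply/eqP; apply/contraT => M0.
have top0 : pihomog mdeg (msize M).-1 M = 0.
  apply: (flow_eq0 GB).
    move=> m; rewrite mcoeff_msupp mcoeff_pihomog.
    by case: ifP; rewrite ?eqxx // -mcoeff_msupp => _; apply: Mneg.
  (* [msize M] is the order plus one, so this is the component of [flow M] in degree [msize M],
     which [msize_flow] excludes. *)
  rewrite flow_pihomog; apply/mpolyP=> m; rewrite mcoeff_pihomog mcoeff0.
  rewrite -mpolySpred //; case: eqP => // mE; apply: memN_msupp_eq0.
  by apply: msize_mdeg_ge; rewrite mE (msize_flow comm).
have : (pihomog mdeg (msize M).-1 M)@_(mlead M) = 0 by rewrite top0 mcoeff0.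
rewrite mcoeff_pihomog -mlead_deg //= eqxx => /eqP.
by rewrite mleadc_eq0 (negbTE M0).
Qed.

End Flow.

End Operators.

(** * Specialisation to rational coefficients *)

Section RationalOperators.
Variables (F : fieldType) (r : nat).
Local Notation K := (ratfun F r).
Local Notation iota := (@FracField.tofrac {mpoly F[r]} : {rmorphism _ -> _}).
Implicit Types (f g : K) (L M : dop F r).

Lemma ratfun_fracP f : exists p q : {mpoly F[r]}, iota q != 0 /\ f = iota p / iota q.
Proof.
exists (\n_(generic_quotient.repr f)), (\d_(generic_quotient.repr f)).
by split; [rewrite tofrac_eq0; exact: denom_ratioP | exact: ratfun_repr].
Qed.

Lemma ratfun_deriv_quotient i (p q : {mpoly F[r]}) : iota q != 0 ->
  ratfun_deriv i (iota p / iota q)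
  = iota (p^`M(i) * q - p * q^`M(i)) / iota (q ^+ 2).
Proof. by rewrite tofrac_eq0 => q0; apply: ratfun_derivE. Qed.

Lemma ratfun_deriv_is_zmod_morphism i : zmod_morphism (@ratfun_deriv F r i).
Proof.
exact: (quotient_rule_zmod_morphism (der := @mderiv r F i) ratfun_fracP
  (mderivM i) (@ratfun_deriv_quotient i)).
Qed.

HB.instance Definition _ i := GRing.isZmodMorphism.Build K K
  (@ratfun_deriv F r i) (ratfun_deriv_is_zmod_morphism i).

Lemma ratfun_derivM i f g :
  ratfun_deriv i (f * g) = ratfun_deriv i f * g + f * ratfun_deriv i g.
Proof.
exact: (quotient_rule_derivation (der := @mderiv r F i) ratfun_fracP
  (mderivM i) (@ratfun_deriv_quotient i)).
Qed.

Lemma ratfun_deriv_tofrac i (p : {mpoly F[r]}) :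
  ratfun_deriv i (iota p) = iota p^`M(i).
Proof.
exact: (quotient_rule_ext (der := @mderiv r F i)
  (mderivM i) (@ratfun_deriv_quotient i)).
Qed.

Lemma ratfun_deriv_comm i j f :
  ratfun_deriv i (ratfun_deriv j f) = ratfun_deriv j (ratfun_deriv i f).
Proof.
apply: (quotient_rule_comm (der1 := @mderiv r F i) (der2 := @mderiv r F j)
  (d1 := @ratfun_deriv F r i) (d2 := @ratfun_deriv F r j) ratfun_fracP).
- exact: ratfun_derivM.
- exact: ratfun_derivM.
- exact: ratfun_deriv_tofrac.
- exact: ratfun_deriv_tofrac.
- by move=> p; apply: mderiv_comm.
Qed.

Local Notation D := (fun i => @ratfun_deriv F r i : {additive K -> K}).

Lemma dop_actE L f : dop_act L f = act D L f.
Proof. by []. Qed.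

Lemma laplacianE (G : 'M[F]_r) : laplacian G = lap iota (invmx G).
Proof.
rewrite /laplacian /dop_const raddf_sum; apply: eq_bigr => i _.
rewrite raddf_sum; apply: eq_bigr => j _ /=.
by rewrite map_mpolyZ rmorphM /= !map_mpolyX.
Qed.

Lemma calogero_moserE (G : 'M[F]_r) (gT : finGroupType) (W : {group gT})
    (rho : mx_representation F W r) c alpha :
  exists V : ratfun F r, calogero_moser G rho c alpha = lap iota (invmx G) - V%:MP.
Proof. by eexists; rewrite /calogero_moser laplacianE -raddf_sum. Qed.

(** Over the product of the denominators, equality of the two degrees makes the numerator
    homogeneous. *)
Lemma ratfun_homog_negdegB k f g : (k < 0)%R ->
  ratfun_homog k f -> ratfun_homog k g -> negdeg iota (f - g).
Proof.
move=> k0 [dp [dq [p [q [[hp hq q0] [-> dpq]]]]]].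
move=> [du [dv [u [v [[hu hv v0] [-> duv]]]]]].
have e : (dp + dv = du + dq)%N by lia.
exists (dp + dv)%N, (dq + dv)%N, (p * v - u * q), (q * v); split.
- by apply: rpredB; [exact: dhomogM | rewrite e; exact: dhomogM].
- exact: dhomogM.
- by rewrite mulf_neq0.
- by rewrite (quotientB (iota := iota)) ?tofrac_eq0.
- by lia.
Qed.

(** A nonzero homogeneous symbol determines the order of [L], namely d. In degree d the coefficients
    are those of the symbol; above d both sides vanish. *)
Lemma dop_symbol_const L (P : {mpoly F[r]}) d : P != 0 -> P \is d.-homog ->
  dop_symbol L = dop_const P ->
  forall m, (d <= mdeg m)%N -> L@_m = (dop_const P)@_m.
Proof.
move=> P0 hP symL m.
have CE k : (dop_const P)@_k = (P@_k)%:MP%:F by rewrite mcoeff_map_mpoly.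
have hC : dop_const P \is d.-homog.
  apply/dhomogP => k; rewrite mcoeff_msupp CE tofrac_eq0 mpolyC_eq0.
  by rewrite -mcoeff_msupp => /(dhomog_mf hP).
have C0 : dop_const P != 0.
  apply: contraNneq P0 => C0; apply/eqP/mpolyP => k; apply/eqP.
  by rewrite mcoeff0 -(mpolyC_eq0 r) -tofrac_eq0 -CE C0 mcoeff0.
have dE : (msize L).-1 = d.
  by apply: (dhomog_uniq C0 _ hC); rewrite -symL; apply: pihomogP.
rewrite leq_eqVlt => /predU1P[dm|lt_dm].
  by rewrite -symL /dop_symbol mcoeff_pihomog dE dm eqxx.
rewrite (dhomog_nemf_coeff hC) ?gtn_eqF //.
apply/memN_msupp_eq0/msize_mdeg_ge; move: lt_dm; rewrite -dE.
by case: (msize L).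
Qed.

Lemma quantum_integrals_uniq (G : 'M[F]_r) (gT : finGroupType) (W : {group gT})
    (rho : mx_representation F W r) c alpha (P : 'I_r -> {mpoly F[r]}) d
    (L L' : 'I_r -> dop F r) :
  [pchar F] =i pred0 -> inner_product G ->
  (forall j, P j != 0) -> (forall j, P j \is (d j).-homog) ->
  quantum_integrals P d (calogero_moser G rho c alpha) L ->
  quantum_integrals P d (calogero_moser G rho c alpha) L' ->
  L =1 L'.
Proof.
move=> F0 [Gsym Gu] P0 hP [symL homL L1 comL] [symL' homL' L'1 comL'] j.
move: (calogero_moserE G rho c alpha) L1 L'1.
move: (calogero_moser G rho c alpha) => H [V HE] L1 L'1.
(* The index of the Hamiltonian exists since [j] inhabits ['I_r]. *)
have [j0 j00] : exists j0 : 'I_r, nat_of_ord j0 = 0%N.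
  by exists (Ordinal (leq_ltn_trans (leq0n j) (ltn_ord j))).
apply/eqP; rewrite -subr_eq0; apply/eqP.
have Bsym : (invmx G)^T = invmx G by rewrite trmx_inv Gsym.
apply: (@commute_lap_eq0 F r K iota D F0 _ _ _ _ (invmx G) Bsym G V).
- by move=> p; rewrite tofrac_eq0.
- exact: ratfun_derivM.
- exact: ratfun_deriv_comm.
- exact: ratfun_deriv_tofrac.
- exact: mulmxV.
- move=> m; rewrite mcoeff_msupp mcoeffB => Mm.
  apply: ratfun_homog_negdegB (homL j m) (homL' j m).
  (* The degree of the coefficient is [mdeg m - d j], and coefficients with [d j <= mdeg m] cancel
     in the difference. *)
  suff: (mdeg m < d j)%N by lia.
  rewrite ltnNge; apply: contra Mm => le_dm.
  by rewrite !(dop_symbol_const (P0 j) (hP j)) ?subrr.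
move=> f; rewrite -HE -!dop_actE !dop_actE !actB raddfB /= -!dop_actE.
by have := comL j0 j f; have := comL' j0 j f; rewrite L1 // L'1 // => -> ->.
Qed.

End RationalOperators.

Theorem proposition2p21 (R : realType) (r : nat) (G : 'M[R[i]]_r)
    (gT : finGroupType) (W : {group gT}) (rho : mx_representation R[i] W r)
    (c : gT -> R[i]) (alpha : gT -> 'cV[R[i]]_r)
    (P : 'I_r -> {mpoly R[i][r]}) (d : 'I_r -> nat)
    (L L' : 'I_r -> dop R[i] r) :
  inner_product G ->
  real_reflection_group G rho ->
  mx_irreducible rho ->
  conj_invariant G rho c ->
  reflection_roots G rho alpha ->
  invariant_generators G rho P d ->
  quantum_integrals P d (calogero_moser G rho c alpha) L ->
  quantum_integrals P d (calogero_moser G rho c alpha) L' ->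
  forall j : 'I_r, L j = L' j.
Proof.
move=> hG _ _ _ _ [hP indP _ _].
apply: quantum_integrals_uniq hG _ hP; first exact: Num.Theory.pchar_num.
(* Were [P j] zero, ['X_j] would be an algebraic relation among the generators. *)
move=> j; apply: contraNneq (oner_neq0 R[i]) => Pj0.
have /(congr1 (mcoeff U_(j))) : ('X_j : {mpoly R[i][r]}) = 0.
  by apply: indP; rewrite comp_mpolyXU -tnth_nth tnth_mktuple.
by rewrite mcoeffXU eqxx mcoeff0 => /eqP.
Qed.
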